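(* Let $n\geq1$, $r=2^n$ and $M=22^{2^n}+1$. Let $\pi=1+\zeta_{11}^7+\zeta_{11}^8\in\mathbb{Z}[\zeta_{22}]$ and $\alpha=(\pi/\bar\pi)^{\tau}$, where $\tau=1+3\sigma_{-7}+5\sigma_9+7\sigma_{-3}+9\sigma_5$. For $k\ge0$ and $1\leq j\leq5$ define $S_k^{(j)}=f^{(j)}(\alpha_1^{(k)},\ldots,\alpha_5^{(k)})$, where $f^{(j)}$ is the $j$-th elementary symmetric polynomial in $5$ variables, $\alpha_1^{(k)}=\alpha^{22^k}+\bar\alpha^{22^k}$, and $\alpha_i^{(k)}=\sigma_{2i-1}(\alpha_1^{(k)})$ for $2\leq i\leq5$. Suppose that every integer $x$ with $1<x<11^r$ and $x^{10}\equiv1\pmod{11^r}$ does not divide $M$. Then $M$ is prime if and only if $$S_{r-1}^{(1)}\equiv-1,\quad S_{r-1}^{(2)}\equiv-4,\quad S_{r-1}^{(3)}\equiv3,\quad S_{r-1}^{(4)}\equiv3,\quad S_{r-1}^{(5)}\equiv-1\pmod M.$$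
   Context: $\zeta_m=e^{2\pi\sqrt{-1}/m}$ and a bar denotes complex conjugation. For $c$ coprime to $22$, $\sigma_c\in G=\mathrm{Gal}(\mathbb{Q}(\zeta_{22})/\mathbb{Q})$ sends $\zeta_{22}$ to $\zeta_{22}^c$; $1$ denotes $\sigma_1$ in $\mathbb{Z}[G]$. For $\tau=\sum_{\sigma\in G}k_\sigma\sigma\in\mathbb{Z}[G]$ and $\beta\neq0$, $\beta^\tau:=\prod_{\sigma}\sigma(\beta)^{k_\sigma}$. The $S_k^{(j)}$ are rational numbers with denominators prime to $M$; congruences modulo $M$ are understood in the ring of rationals with denominator prime to $M$. *)

(* Defs.v *)
From mathcomp Require Import all_boot all_order all_fingroup all_algebra.
From mathcomp Require Import all_solvable all_field.
From mathcomp Require Import mpoly.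

Set Implicit Arguments.
Unset Strict Implicit.
Unset Printing Implicit Defensive.

Import Order.TTheory GRing.Theory Num.Theory.
Local Open Scope ring_scope.

(* [m.-root (-1)] is the m-th root of -1 of least nonnegative argument, i.e.
   e^(pi i / m) for m > 1 (and -1 for m = 1), so its square is e^(2 pi i / m). *)
Definition zeta (m : nat) : algC := (m.-root (-1)) ^+ 2.

Section Cyclotomic.

(* L is Q(zeta_22) and z its element zeta_22; bar is complex conjugation on L
   and sigma c is the automorphism z |-> z ^ c for c coprime to 22.  These
   properties are hypotheses of the theorem. *)
Variables (L : splittingFieldType rat) (z : L) (bar : L -> L).
Variable sigma : int -> gal_of {:L}.

(* Elements of Z[G] for G = Gal(L/Q), as functions from G to the integers. *)
Definition intGalRing := {ffun gal_of {:L} -> int}.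

Definition galring_of (s : gal_of {:L}) : intGalRing :=
  [ffun t => (t == s)%:Z].

Definition galpow (beta : L) (t : intGalRing) : L :=
  \prod_(s in 'Gal({:L} / 1%AS)%g) s beta ^ t s.

Definition tau : intGalRing :=
  galring_of (sigma 1) + galring_of (sigma (-7)) *+ 3 + galring_of (sigma 9) *+ 5
  + galring_of (sigma (-3)) *+ 7 + galring_of (sigma 5) *+ 9.

(* zeta_11 = zeta_22 ^ 2 *)
Definition piL : L := 1 + (z ^+ 2) ^+ 7 + (z ^+ 2) ^+ 8.

Definition alpha : L := galpow (piL / bar piL) tau.

Definition alpha1 (k : nat) : L := alpha ^+ (22 ^ k) + bar alpha ^+ (22 ^ k).

(* The index is shifted by one: [alpha_ k i] is the paper's alpha_{i+1}^{(k)},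
   which for i = 0 is alpha_1^{(k)} itself. *)
Definition alpha_ (k : nat) (i : 'I_5) : L :=
  if i == ord0 then alpha1 k else sigma (2 * i.+1 - 1)%N%:Z (alpha1 k).

Definition S_ (k j : nat) : L := (mesym 5 L j).@[alpha_ k].

End Cyclotomic.

Definition prime_to_denq (M : nat) (q : rat) : bool := coprime `|denq q| M.

(* x and y lie in the subring Z_(M) of rationals with denominator prime to M,
   and x - y is in the ideal M * Z_(M). *)
Definition eqmodQ (L : splittingFieldType rat) (M : nat) (x y : L) : Prop :=
  exists a b : rat,
    [/\ x = ratr a, y = ratr b, prime_to_denq M a, prime_to_denq M b
      & exists2 c : rat, prime_to_denq M c & a - b = M%:R * c].

(* Main.v *)
(* Write N = 22 ^ (r - 1), so that M - 1 = 22 N.  If M is prime, reduce at a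
   prime above M.  The element pi has norm 23, and the Gauss sum g over F_23 of
   a character of order 11 satisfies the Stickelberger-type identity expressing
   g ^ 33 as a product of Jacobi sums, which up to units are products of
   conjugates of pi.  Frobenius multiplies g by the character value at M, so
   alpha ^ (2 N) = zeta_11 ^ 4; as alpha is 23 times a square and 23 is a square
   modulo M, also alpha ^ (11 N) = 1, whence alpha ^ N = zeta_11 ^ 2.  The
   S^(j) are then the elementary symmetric functions of the Gaussian periods
   zeta_11 ^ c + zeta_11 ^ - c.  Conversely, if the congruences hold and q is
   the least prime factor of a composite M, then modulo q the power alpha ^ N is
   a primitive 11th root of unity, so 11 ^ r divides the order of alpha, hence
   q ^ 10 - 1, contrary to the hypothesis because q < 11 ^ r. *)
Require Import Defs.
From mathcomp Require Import all_boot all_order all_fingroup all_algebra.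
From mathcomp Require Import all_solvable all_field.
From mathcomp Require Import mpoly ring zify.
From Stdlib Require Import Lia.

Set Implicit Arguments.
Unset Strict Implicit.
Unset Printing Implicit Defensive.

Import Order.TTheory GRing.Theory Num.Theory.
Local Open Scope ring_scope.

(** * Exponent sums at roots of unity, Jacobi sums and Gaussian periods *)

Section ExponentSums.
Variable R : comNzRingType.
Implicit Types (v : R) (s t : seq nat).

(* Identities between values of polynomials with nonnegative coefficients at
   a root of unity reduce to equality of exponent lists modulo its order. *)
Definition expsum v s : R := \sum_(i <- s) v ^+ i.

Definition addexps s t := [seq (i + j)%N | i <- s, j <- t].

Definition copies k s := flatten (nseq k s).

Lemma expsum_cat v s t : expsum v (s ++ t) = expsum v s + expsum v t.
Proof. by rewrite /expsum big_cat. Qed.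

Lemma expsumM v s t : expsum v s * expsum v t = expsum v (addexps s t).
Proof.
rewrite /expsum big_allpairs_dep mulr_suml; apply: eq_bigr => i _.
by rewrite mulr_sumr; apply: eq_bigr => j _; rewrite exprD.
Qed.

Lemma expsumX v k s : expsum (v ^+ k) s = expsum v [seq (k * i)%N | i <- s].
Proof. by rewrite /expsum big_map; apply: eq_bigr => i _; rewrite exprM. Qed.

Lemma expsum_shift v k s :
  v ^+ k * expsum v s = expsum v [seq (k + i)%N | i <- s].
Proof.
by rewrite /expsum big_map mulr_sumr; apply: eq_bigr => i _; rewrite exprD.
Qed.

Lemma expsum_copies v k s : expsum v (copies k s) = expsum v s *+ k.
Proof.
elim: k => [|k IHk]; first by rewrite /expsum big_nil.
by rewrite /copies /= expsum_cat -/(copies k s) IHk mulrS.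
Qed.

(** Boolean and computable, so that each concrete identity is settled by [vm_compute]. *)
Definition eqexps m s t :=
  sort leq [seq i %% m | i <- s]%N == sort leq [seq i %% m | i <- t]%N.

Lemma expsum_eq m v s t :
  v ^+ m = 1 -> eqexps m s t -> expsum v s = expsum v t.
Proof.
move=> vm1 /eqP eq_st.
have modE r : expsum v r = expsum v (sort leq [seq i %% m | i <- r]%N).
  have eq_r : perm_eq (sort leq [seq i %% m | i <- r]%N) [seq i %% m | i <- r]%N.
    by rewrite perm_sort.
  rewrite /expsum (perm_big _ eq_r) big_map.
  by apply: eq_bigr => i _; rewrite expr_mod.
by rewrite (modE s) eq_st -modE.
Qed.

(** For prime [m] the hypothesis says that [v] is a root of the [m]-th cyclotomic polynomial, in a
    form that makes sense over any commutative ring. *)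
Lemma expsum_iota_root m v : expsum v (iota 0 m) = 0 -> v ^+ m = 1.
Proof.
move=> Phi0; apply/eqP; rewrite -subr_eq0 subrX1.
have -> : \sum_(i < m) v ^+ i = 0; last by rewrite mulr0.
by rewrite -[RHS]Phi0 /expsum -(big_mkord predT) /index_iota subn0.
Qed.

Lemma Phi11X v c :
  expsum v (iota 0 11) = 0 -> (0 < c < 11)%N -> expsum (v ^+ c) (iota 0 11) = 0.
Proof.
move=> Phi0 c_bnd; have v11 := expsum_iota_root Phi0.
rewrite expsumX -[RHS]Phi0; apply: expsum_eq v11 _.
by move: c c_bnd; do 11?[case=> //].
Qed.

(* [piE zeta_11] is the paper's pi. *)
Definition piE v : R := expsum v [:: 0; 7; 8].

(* The Jacobi sum over F_23 of the character of order 11 sending 5 to v. *)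
Definition jacobi_exps :=
  flatten [seq nseq x.1 x.2 |
            x <- zip [:: 0; 2; 4; 2; 2; 4; 0; 3; 2; 2; 0]%N (iota 0 11)].
Definition jacobi v : R := expsum v jacobi_exps.

(** Stickelberger's factorisation of the Jacobi sum into conjugates of pi, with the unit made
    explicit. *)
Lemma jacobi_piE v : expsum v (iota 0 11) = 0 ->
  jacobi v = - v ^+ 3 * (piE (v ^+ 10) * piE (v ^+ 2) * piE (v ^+ 3)
                        * piE (v ^+ 7) * piE (v ^+ 6)).
Proof.
move=> Phi0; have v11 := expsum_iota_root Phi0.
apply/eqP; rewrite mulNr -addr_eq0 /piE !expsumX !expsumM expsum_shift.
(* Both sides together have 21 + 3^5 = 264 = 24 * 11 exponents, hence 24 copies of the vanishing
   sum. *)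
rewrite -expsum_cat -[X in _ == X](mul0rn _ 24) -Phi0 -expsum_copies.
by apply/eqP/(expsum_eq v11); vm_compute.
Qed.

Lemma jacobi_norm v : expsum v (iota 0 11) = 0 ->
  jacobi v * jacobi (v ^+ 10) = 23.
Proof.
move=> Phi0; have v11 := expsum_iota_root Phi0.
rewrite /jacobi expsumX expsumM; transitivity (expsum v (nseq 23 0%N)); last first.
  by rewrite /expsum big_nseq expr0 iter_addr addr0.
rewrite -[RHS]addr0 -[X in _ = _ + X](mul0rn _ 38) -Phi0 -expsum_copies.
by rewrite -expsum_cat; apply: (expsum_eq v11); vm_compute.
Qed.

(** The factors in [jacobi_piE] at [v] and at [v ^+ 10] exhaust the ten conjugates and the units
    cancel, so this is [jacobi_norm]. *)
Lemma piE_norm v : expsum v (iota 0 11) = 0 ->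
  piE v * piE (v ^+ 2) * piE (v ^+ 3) * piE (v ^+ 4) * piE (v ^+ 5)
  * piE (v ^+ 6) * piE (v ^+ 7) * piE (v ^+ 8) * piE (v ^+ 9)
  * piE (v ^+ 10) = 23.
Proof.
move=> Phi0; have v11 := expsum_iota_root Phi0.
have red k l : (10 * k %% 11 = l)%N -> (v ^+ 10) ^+ k = v ^+ l.
  by move=> <-; rewrite expr_mod ?exprM.
rewrite -(jacobi_norm Phi0) (jacobi_piE Phi0) jacobi_piE ?Phi11X //.
rewrite (red 10 1)%N // (red 2 9)%N // (red 3 8)%N // (red 7 4)%N // (red 6 5)%N //.
by rewrite mulrACA mulrNN -exprD v11 mul1r expr1; ring.
Qed.

(** Over the complex numbers the [w i] are the conjugates of 2 cos (2 pi / 11), with minimal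
    polynomial t^5 + t^4 - 4 t^3 - 3 t^2 + 3 t + 1. *)
Lemma elementary_periods v : expsum v (iota 0 11) = 0 ->
  let w i := v ^+ i + v ^+ (10 * i) in
  let a := w 1%N in let b := w 3%N in let c := w 5%N in
  let d := w 7%N in let e := w 9%N in
  [/\ a + b + c + d + e = -1,
      a * b + a * c + a * d + a * e + b * c + b * d + b * e + c * d + c * e
      + d * e = -4,
      a * b * c + a * b * d + a * b * e + a * c * d + a * c * e + a * d * e
      + b * c * d + b * c * e + b * d * e + c * d * e = 3,
      a * b * c * d + a * b * c * e + a * b * d * e + a * c * d * e
      + b * c * d * e = 3
    & a * b * c * d * e = -1].
Proof.
move=> Phi0 w; have v11 := expsum_iota_root Phi0.
have wE i : w i = expsum v [:: i; 10 * i]%N by rewrite /expsum big_cons big_seq1.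
have nat0 k : k%:R = expsum v (nseq k 0%N).
  by rewrite /expsum big_nseq expr0 iter_addr addr0.
have copies0 k : expsum v (copies k (iota 0 11)) = 0.
  by rewrite expsum_copies Phi0 mul0rn.
move=> a b c d e; rewrite /a /b /c /d /e !wE !expsumM -!expsum_cat; split.
- apply/eqP; rewrite -addr_eq0 -[X in _ + X]mulr1n nat0 -expsum_cat -(copies0 1%N).
  by apply/eqP/(expsum_eq v11); vm_compute.
- apply/eqP; rewrite -addr_eq0 (nat0 4%N) -expsum_cat -(copies0 4%N).
  by apply/eqP/(expsum_eq v11); vm_compute.
- rewrite (nat0 3%N) -[RHS]addr0 -(copies0 7%N) -expsum_cat.
  by apply: (expsum_eq v11); vm_compute.
- rewrite (nat0 3%N) -[RHS]addr0 -(copies0 7%N) -expsum_cat.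
  by apply: (expsum_eq v11); vm_compute.
- apply/eqP; rewrite -addr_eq0 -[X in _ + X]mulr1n nat0 -expsum_cat -(copies0 3%N).
  by apply/eqP/(expsum_eq v11); vm_compute.
Qed.

End ExponentSums.

(** * Gauss sums over F_23 and the action of Frobenius on them *)

Section GaussSums.
Variables (R : comNzRingType) (theta : R).

(* theta is the product of the 11th root of unity [theta ^+ 23] and the 23rd
   root of unity [theta ^+ 231]. *)
Hypothesis Phi11_theta : expsum (theta ^+ 23) (iota 0 11) = 0.
Hypothesis Phi23_theta : expsum (theta ^+ 231) (iota 0 23) = 0.

(** 5 is a primitive root modulo 23, so pairing this list with [iota 0 22] tabulates discrete
    logarithms. *)
Definition powers_of_5_mod23 := traject (fun x => 5 * x %% 23)%N 1%N 22.

Definition gauss_exps a :=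
  [seq (23 * a * x.1 + 231 * x.2) %% 253 |
    x <- zip (iota 0 22) powers_of_5_mod23]%N.

(* The Gauss sum of the a-th power of the character sending 5 to theta ^+ 23. *)
Definition gauss a : R := expsum theta (gauss_exps a).

Let u := theta ^+ 23.

Let theta253 : theta ^+ 253 = 1.
Proof. by rewrite (exprM theta 23 11) (expsum_iota_root Phi11_theta). Qed.

Let copies11 k :
  expsum theta (copies k [seq (23 * i)%N | i <- iota 0 11]) = 0.
Proof. by rewrite expsum_copies -expsumX Phi11_theta mul0rn. Qed.

Let shifts23 s : expsum theta
  (flatten [seq [seq (i + 231 * j)%N | j <- iota 0 23] | i <- s]) = 0.
Proof.
elim: s => [|i s IHs]; first by rewrite /expsum big_nil.
rewrite map_cons -[flatten _]/(_ ++ flatten _) expsum_cat IHs addr0.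
have -> : [seq (i + 231 * j)%N | j <- iota 0 23]
    = [seq (i + k)%N | k <- [seq (231 * j)%N | j <- iota 0 23]].
  by rewrite -map_comp.
by rewrite -expsum_shift -expsumX Phi23_theta mulr0.
Qed.

(** In the square, the pairs x, y with x + y nonzero give the right side; those with y = - x give
    each 11th root of unity twice, which is the vanishing [copies11 2]. *)
Lemma gauss_sqr a b : (0 < a < 11)%N -> b = (2 * a %% 11)%N ->
  gauss a ^+ 2 = jacobi (u ^+ a) * gauss b.
Proof.
move=> a_bnd ->; rewrite /jacobi /u -exprM expsumX expr2 !expsumM.
rewrite -[RHS]addr0 -(copies11 2) -expsum_cat; apply: (expsum_eq theta253).
have /allP : all (fun a => eqexps 253 (addexps (gauss_exps a) (gauss_exps a))
    (addexps [seq (23 * a * i)%N | i <- jacobi_exps] (gauss_exps (2 * a %% 11))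
     ++ copies 2 [seq (23 * i)%N | i <- iota 0 11])) (iota 1 10)
  by vm_compute.
by apply; rewrite mem_iota.
Qed.

Lemma gauss_norm : gauss 1 * gauss 10 = 23.
Proof.
rewrite expsumM; transitivity (expsum theta (nseq 23 0%N)); last first.
  by rewrite /expsum big_nseq expr0 iter_addr addr0.
rewrite -[LHS]addr0 -(copies11 2) -expsum_cat -[RHS]addr0.
(* Products are grouped by the ratio 5^k of their arguments. For k = 11 the ratio is -1 and all 22
   terms are 1; for other k one term is missing from a full sum over the 23rd roots of unity. The
   two copies supply one term for each k. *)
rewrite -[X in _ = _ + X](shifts23 [seq (23 * k)%N | k <- rem 11%N (iota 0 22)]).
by rewrite -expsum_cat; apply: (expsum_eq theta253); vm_compute.
Qed.

(** Doubling the character runs through 1, 2, 4, 8, 5, 10, since 2^5 = -1 modulo 11, and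
    [gauss_norm] closes the chain. *)
Lemma gauss_exp33 : gauss 1 ^+ 33 =
  23 * jacobi u ^+ 16 * jacobi (u ^+ 2) ^+ 8 * jacobi (u ^+ 4) ^+ 4
     * jacobi (u ^+ 8) ^+ 2 * jacobi (u ^+ 5).
Proof.
have g1 : gauss 1 ^+ 2 = jacobi u * gauss 2 by rewrite (gauss_sqr (b := 2)) ?expr1.
have g2 : gauss 2 ^+ 2 = jacobi (u ^+ 2) * gauss 4 by apply: gauss_sqr.
have g4 : gauss 4 ^+ 2 = jacobi (u ^+ 4) * gauss 8 by apply: gauss_sqr.
have g8 : gauss 8 ^+ 2 = jacobi (u ^+ 8) * gauss 5 by apply: gauss_sqr.
have g5 : gauss 5 ^+ 2 = jacobi (u ^+ 5) * gauss 10 by apply: gauss_sqr.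
have sqrX (x y j : R) k : x ^+ 2 = j * y -> x ^+ (2 * k) = j ^+ k * y ^+ k.
  by move=> x2; rewrite exprM x2 exprMn.
rewrite exprSr (sqrX _ _ _ 16 g1) (sqrX _ _ _ 8 g2) (sqrX _ _ _ 4 g4).
rewrite (sqrX _ _ _ 2 g8) g5 -gauss_norm.
move: (gauss 1) (gauss 10) (jacobi _) (jacobi _) (jacobi _) (jacobi _) (jacobi _).
by move=> *; ring.
Qed.

(* 2 generates the group of squares modulo 23. *)
Definition quadratic_period : R :=
  expsum theta
    [seq (231 * x)%N | x <- traject (fun x => 2 * x %% 23)%N 1%N 11].

(** The base is the quadratic Gauss sum modulo 23, as the periods over squares and nonsquares add up
    to -1. *)
Lemma quadratic_period_sqr : (2 * quadratic_period + 1) ^+ 2 = - 23.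
Proof.
have eq0 : quadratic_period ^+ 2 + quadratic_period + 6 = 0.
  have -> : 6 = expsum theta (nseq 6 0%N) :> R.
    by rewrite /expsum big_nseq expr0 iter_addr addr0.
  rewrite expr2 expsumM -!expsum_cat -[RHS](shifts23 (nseq 6 0%N)).
  by apply: (expsum_eq theta253); vm_compute.
have -> : (2 * quadratic_period + 1) ^+ 2
    = 4 * (quadratic_period ^+ 2 + quadratic_period + 6) - 23 by ring.
by rewrite eq0 mulr0 add0r.
Qed.

Section Frobenius.
Variable M : nat.
Hypotheses (pcharM : M \in [pchar R]) (M253 : (M %% 253 = 232)%N).

Lemma expsum_Frobenius (v : R) s :
  expsum v s ^+ M = expsum v [seq (M * i)%N | i <- s].
Proof.
rewrite -(pFrobenius_autE pcharM) /expsum rmorph_sum big_map.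
by apply: eq_bigr => i _; rewrite rmorphXn /= pFrobenius_autE exprM.
Qed.

Let expsum_thetaM s : expsum theta s ^+ M = expsum theta [seq (232 * i)%N | i <- s].
Proof.
rewrite expsum_Frobenius -!expsumX -[in LHS](expr_mod M theta253).
by rewrite M253.
Qed.

(** [M] is 1 modulo 11 and 2 modulo 23, so Frobenius keeps the multiplicative character and replaces
    x by 2 x in the additive one. As 2 = 5^2 in F_23, this costs a factor u^-2. *)
Lemma gauss_Frobenius : u ^+ 2 * gauss 1 ^+ M = gauss 1.
Proof.
rewrite expsum_thetaM -exprM expsum_shift.
by apply: (expsum_eq theta253); vm_compute.
Qed.

(** Multiplication by 2 permutes the nonzero squares modulo 23. *)
Lemma quadratic_period_Frobenius : quadratic_period ^+ M = quadratic_period.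
Proof.
by rewrite expsum_thetaM; apply: (expsum_eq theta253); vm_compute.
Qed.

End Frobenius.

End GaussSums.

(* [alphaE zeta_11] is the paper's alpha: sigma_-7 and sigma_-3 raise zeta_11
   to the powers 4 and 8. *)
Definition alphaE (F : fieldType) (v : F) : F :=
  let p c := piE (v ^+ c) in
  p 1 / p 10 * (p 4 / p 7) ^+ 3 * (p 9 / p 2) ^+ 5 * (p 8 / p 3) ^+ 7
  * (p 5 / p 6) ^+ 9.

Lemma piE_neq0 (F : fieldType) (v : F) c :
  expsum v (iota 0 11) = 0 -> 23 != 0 :> F -> (0 < c < 11)%N ->
  piE (v ^+ c) != 0.
Proof.
move=> Phi0 nz23 c_bnd; apply: contraNneq nz23 => p0.
rewrite -(piE_norm Phi0); apply/eqP.
by move: c c_bnd p0; do 11?[case=> //]; rewrite ?expr1 => _ ->;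
  rewrite ?(mul0r, mulr0).
Qed.

(** * The power residue of alpha at a prime above [M] *)

Section PowerResidue.
Variables (F : fieldType) (v zeta23 : F) (M N : nat).
Hypothesis Phi11_v : expsum v (iota 0 11) = 0.
Hypothesis Phi23_zeta : expsum zeta23 (iota 0 23) = 0.
Hypotheses (pcharM : M \in [pchar F]) (M253 : (M %% 253 = 232)%N).
Hypotheses (MN : M = (22 * N).+1) (N22 : (22 %| N)%N).

Let theta := v * zeta23.
Let v11 : v ^+ 11 = 1 := expsum_iota_root Phi11_v.

Let theta_v : theta ^+ 23 = v.
Proof.
rewrite /theta exprMn (expsum_iota_root Phi23_zeta) mulr1.
by rewrite -(expr_mod 23 v11) expr1.
Qed.

Let theta_zeta : theta ^+ 231 = zeta23.
Proof.
rewrite /theta exprMn -(expr_mod 231 v11) expr0 mul1r.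
by rewrite -(expr_mod 231 (expsum_iota_root Phi23_zeta)) expr1.
Qed.

Let Phi11_theta : expsum (theta ^+ 23) (iota 0 11) = 0.
Proof. by rewrite theta_v. Qed.

Let Phi23_theta : expsum (theta ^+ 231) (iota 0 23) = 0.
Proof. by rewrite theta_zeta. Qed.

Let M_prime : prime M := pcharf_prime pcharM.

Let nz23 : 23 != 0 :> F.
Proof.
rewrite -(dvdn_pcharf pcharM) dvdn_prime2 //.
by apply: contra_eqN M253 => /eqP->.
Qed.

Let M11 : (M %% 11 = 1)%N.
Proof. by rewrite -(@modn_dvdm 253) // M253. Qed.

Let p c := piE (v ^+ c).

(** Frobenius fixes [v], so exponent sums at [v] lie in the prime field and Fermat's little theorem
    applies. *)
Let expsumM1 s : expsum v s != 0 -> expsum v s ^+ (22 * N) = 1.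
Proof.
move=> nz; apply: (mulfI nz); rewrite mulr1 -exprS -MN.
rewrite (expsum_Frobenius pcharM) -expsumX.
by rewrite -(expr_mod M v11) M11 expr1.
Qed.

Let pM1 c : (0 < c < 11)%N -> p c ^+ (22 * N) = 1.
Proof.
move=> c_bnd; have := piE_neq0 Phi11_v nz23 c_bnd.
by rewrite /p /piE expsumX; apply: expsumM1.
Qed.

Let p_neq0 c : (0 < c < 11)%N -> p c != 0.
Proof. exact: piE_neq0. Qed.

Let even_N : ~~ odd N.
Proof. by rewrite -dvdn2; apply: dvdn_trans N22. Qed.

(** Euler's criterion: -23 is the square of a Gauss sum fixed by Frobenius, and the sign disappears
    because [11 * N] is even. *)
Let power23 : 23 ^+ (11 * N) = 1 :> F.
Proof.
have e2 := quadratic_period_sqr Phi11_theta Phi23_theta.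
set e := _ + 1 in e2.
have nz_e : e != 0.
  by apply: contraNneq nz23 => e0; rewrite -oppr_eq0 -e2 e0 expr0n.
have <- : (- 23) ^+ (11 * N) = 23 ^+ (11 * N) :> F.
  by rewrite exprNn -signr_odd oddM (negbTE even_N) andbF expr0 mul1r.
rewrite -e2 -exprM mulnA; apply: (mulfI nz_e); rewrite mulr1 -exprS -MN.
rewrite -(pFrobenius_autE pcharM) /e rmorphD rmorphM rmorph1 rmorph_nat /=.
by rewrite pFrobenius_autE (quadratic_period_Frobenius Phi11_theta).
Qed.

Let alphaE_half : alphaE v ^+ (11 * N) = 1.
Proof.
have np c := @p_neq0 c; rewrite -power23.
(* The exponents of tau are odd, and pi has norm 23: alpha is 23 times a square. *)
pose X := p 10 * p 7 ^+ 3 * p 2 ^+ 5 * p 3 ^+ 7 * p 6 ^+ 9.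
pose Y := (p 4 * p 7) * (p 9 * p 2) ^+ 2 * (p 8 * p 3) ^+ 3 * (p 5 * p 6) ^+ 4.
have eqXY : alphaE v * X ^+ 2 = 23 * Y ^+ 2.
  rewrite -(piE_norm Phi11_v) -[piE v]/(p 1) /alphaE -![piE (v ^+ _)]/(p _) /X /Y.
  field.
  by rewrite !np.
have xM1 x k : x ^+ (22 * N) = 1 -> (x ^+ k) ^+ (22 * N) = 1.
  by move=> xM; rewrite exprAC xM expr1n.
have XM1 : (X ^+ 2) ^+ (11 * N) = 1.
  by rewrite -exprM mulnA -[(2 * 11)%N]/22%N /X !exprMn ?xM1 ?pM1 // !mulr1.
have YM1 : (Y ^+ 2) ^+ (11 * N) = 1.
  by rewrite -exprM mulnA -[(2 * 11)%N]/22%N /Y !exprMn ?xM1 ?exprMn ?pM1 // !mulr1.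
have : (alphaE v * X ^+ 2) ^+ (11 * N) = (23 * Y ^+ 2) ^+ (11 * N).
  by rewrite eqXY.
by rewrite [LHS]exprMn [RHS]exprMn XM1 YM1 !mulr1.
Qed.

(** The 11th power residue symbol of [p c], since [2 * N] is (M - 1) / 11. *)
Let q c := p c ^+ (2 * N).

Let q11 c : (0 < c < 11)%N -> q c ^+ 11 = 1.
Proof. by move=> c_bnd; rewrite -exprM mulnAC pM1. Qed.

Let jacobi_q d : (0 < d < 11)%N -> jacobi (v ^+ d) ^+ (2 * N) =
  q (10 * d %% 11) * q (2 * d %% 11) * q (3 * d %% 11) * q (7 * d %% 11)
  * q (6 * d %% 11).
Proof.
move=> d_bnd; have qE c : piE ((v ^+ d) ^+ c) ^+ (2 * N) = q (c * d %% 11).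
  by rewrite /q /p (expr_mod _ v11) -exprM mulnC.
(* The unit of [jacobi_piE] has trivial residue symbol because 11 divides [N]. *)
have vN : ((v ^+ d) ^+ 3) ^+ (2 * N) = 1.
  rewrite -!exprM -(divnK N22).
  rewrite (_ : (d * (3 * _) = 11 * (12 * d * (N %/ 22)))%N); last by lia.
  by rewrite exprM v11 expr1n.
rewrite jacobi_piE ?Phi11X // exprMn exprNn vN -signr_odd oddM !mul1r.
by rewrite !exprMn !qE.
Qed.

Let gauss_residue : gauss theta 1 ^+ (22 * N) = v ^+ 9.
Proof.
have nz_v2 : v ^+ 2 != 0.
  apply/expf_neq0; apply: contraTneq (oner_neq0 F) => v0.
  by rewrite -v11 v0 expr0n eqxx.
have nz_g : gauss theta 1 != 0.
  by apply: contraNneq nz23 => g0; rewrite -(gauss_norm Phi11_theta) // g0 mul0r.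
apply: (mulfI nz_v2); rewrite -exprD v11; apply: (mulfI nz_g).
rewrite mulr1 mulrCA -exprS -MN -{1}theta_v.
exact: gauss_Frobenius.
Qed.

(** The [6 * N]-th power of [gauss_exp33] yields alpha^(2N) = v^4, which together with [alphaE_half]
    determines alpha^N. *)
Lemma alphaE_residue : alphaE v ^+ N = v ^+ 2.
Proof.
have np c := @p_neq0 c.
have nq c : (0 < c < 11)%N -> q c != 0 by move=> /np; apply: expf_neq0.
(* An opaque name for the power map lets it be distributed over products without exposing the
   exponent [2 * N]. *)
have [f fE] : {f : F -> F | forall x, f x = x ^+ (2 * N)}.
  by exists (fun x => x ^+ (2 * N)).
have fM x y : f (x * y) = f x * f y by rewrite !fE exprMn.
have fD x y : f (x / y) = f x / f y by rewrite !fE expr_div_n.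
have fX x k : f (x ^+ k) = f x ^+ k by rewrite !fE exprAC.
have qE c : q c = f (p c) by rewrite fE.
have alpha_q : alphaE v ^+ (2 * N) = q 1 / q 10 * (q 4 / q 7) ^+ 3
    * (q 9 / q 2) ^+ 5 * (q 8 / q 3) ^+ 7 * (q 5 / q 6) ^+ 9.
  rewrite -fE /alphaE -![piE (v ^+ _)]/(p _) !qE; move: (p) => r.
  by rewrite !(fX, fD, fM).
have q23 : 23 ^+ (2 * N) = q 1 * q 2 * q 3 * q 4 * q 5 * q 6 * q 7 * q 8
    * q 9 * q 10.
  by rewrite -(piE_norm Phi11_v) !exprMn.
have alpha2 : alphaE v ^+ (2 * N) = v ^+ 4.
  (* Here 33 * 6 = 22 * 9 and v^81 = v^4. The factor 3 brings the exponents of the [q c] to those of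
     [tau] modulo 11. *)
  have -> : v ^+ 4 = (gauss theta 1 ^+ 33) ^+ (3 * (2 * N)).
    rewrite -exprM (_ : (33 * (3 * (2 * N)) = 22 * N * 9)%N); last by lia.
    by rewrite exprM gauss_residue -exprM -[RHS](expr_mod _ v11).
  rewrite (gauss_exp33 Phi11_theta Phi23_theta) theta_v (mulnC 3).
  rewrite (exprM _ (2 * N) 3).
  have J1 := jacobi_q (isT : 0 < 1 < 11)%N; rewrite expr1 in J1.
  have J2 := jacobi_q (isT : 0 < 2 < 11)%N.
  have J4 := jacobi_q (isT : 0 < 4 < 11)%N.
  have J8 := jacobi_q (isT : 0 < 8 < 11)%N.
  have J5 := jacobi_q (isT : 0 < 5 < 11)%N.
  rewrite alpha_q -[X in _ = X ^+ 3]fE !(fX, fM).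
  rewrite !(fE (jacobi _)) (fE 23) J1 J2 J4 J8 J5 q23.
  (* The exponents of each [q c] on the two sides agree modulo 11. *)
  transitivity (q 1 / q 10 * (q 4 / q 7) ^+ 3
    * (q 9 / q 2) ^+ 5 * (q 8 / q 3) ^+ 7 * (q 5 / q 6) ^+ 9
    * ((q 1 ^+ 11) ^+ 4 * (q 2 ^+ 11) ^+ 7 * (q 3 ^+ 11) ^+ 8 * (q 4 ^+ 11) ^+ 3
      * (q 6 ^+ 11) ^+ 9 * (q 7 ^+ 11) ^+ 6 * (q 8 ^+ 11) * (q 9 ^+ 11) ^+ 2
      * (q 10 ^+ 11) ^+ 5)).
    by rewrite !q11 // !expr1n !mulr1.
  rewrite /modn /=; field.
  by rewrite !nq.
(* Thus alpha^N is the inverse of v^20, that is v^2. *)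
have := alphaE_half; rewrite (_ : (11 * N = N + 2 * N * 5)%N); last by lia.
rewrite exprD (exprM _ (2 * N) 5) alpha2 -exprM => alpha20.
by rewrite -[RHS]mul1r -alpha20 -mulrA -exprD (exprM v 11 2) v11 expr1n mulr1.
Qed.

End PowerResidue.

(** Vieta: compare coefficients in the product of the ['X - x%:P]. *)
Lemma meval_mesym5 (F : fieldType) (w : 'I_5 -> F) :
  let a := w (inord 0) in let b := w (inord 1) in let c := w (inord 2) in
  let d := w (inord 3) in let e := w (inord 4) in
  [/\ (mesym 5 F 1).@[w] = a + b + c + d + e,
      (mesym 5 F 2).@[w] = a * b + a * c + a * d + a * e + b * c + b * d
                           + b * e + c * d + c * e + d * e,
      (mesym 5 F 3).@[w] = a * b * c + a * b * d + a * b * e + a * c * d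
                           + a * c * e + a * d * e + b * c * d + b * c * e
                           + b * d * e + c * d * e,
      (mesym 5 F 4).@[w] = a * b * c * d + a * b * c * e + a * b * d * e
                           + a * c * d * e + b * c * d * e
    & (mesym 5 F 5).@[w] = a * b * c * d * e].
Proof.
move=> a b c d e; pose t := [tuple a; b; c; d; e].
have wE : w =1 tnth t.
  move=> i; rewrite (tnth_nth 0); case: i => [[|[|[|[|[|i]]]]] lt_i] //=;
    by congr w; apply: val_inj; rewrite /= inordK.
have coef (k : 'I_6) :
    (-1) ^+ k * (mesym 5 F k).@[w] = (\prod_(x <- t) ('X - x%:P))`_(5 - k).
  by rewrite (meval_eq _ wE) -mroots_coeff.
have prodE : \prod_(x <- t) ('X - x%:P) =
    'X^5 - (a + b + c + d + e) *: 'X^4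
    + (a * b + a * c + a * d + a * e + b * c + b * d
                           + b * e + c * d + c * e + d * e) *: 'X^3
    - (a * b * c + a * b * d + a * b * e + a * c * d
                           + a * c * e + a * d * e + b * c * d + b * c * e
                           + b * d * e + c * d * e) *: 'X^2
    + (a * b * c * d + a * b * c * e + a * b * d * e
                           + a * c * d * e + b * c * d * e) *: 'X
    - (a * b * c * d * e)%:P.
  rewrite !big_cons big_nil mulr1 -!mul_polyC.
  by rewrite !(polyCD, polyCM); ring.
have := (coef (inord 1), coef (inord 2), coef (inord 3), coef (inord 4),
         coef (inord 5)).
rewrite prodE !inordK // => -[[[[]]]].
rewrite !(coefD, coefN, coefZ, coefXn, coefX, coefC) /= => h1 h2 h3 h4 h5.
have sgnK k (x y : F) : (-1) ^+ k * x = y -> x = (-1) ^+ k * y.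
  by move=> <-; rewrite signrMK.
by rewrite (sgnK _ _ _ h1) (sgnK _ _ _ h2) (sgnK _ _ _ h3) (sgnK _ _ _ h4)
           (sgnK _ _ _ h5); split; ring.
Qed.

(** Complex conjugation is written as [v ^+ 10], so that the same formula makes sense in positive
    characteristic. *)
Definition trace_pow (F : fieldType) k (v : F) : F :=
  alphaE v ^+ (22 ^ k) + alphaE (v ^+ 10) ^+ (22 ^ k).

(** * Symmetric functions of the traces in a residue field *)

Section Residues.
Variable F : fieldType.
Implicit Type v : F.

Lemma alphaE_conj v : expsum v (iota 0 11) = 0 -> 23 != 0 :> F ->
  alphaE v * alphaE (v ^+ 10) = 1.
Proof.
move=> Phi0 nz23; have v11 := expsum_iota_root Phi0.
have np c := @piE_neq0 F v c Phi0 nz23.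
have vX k l : (10 * k %% 11 = l)%N -> (v ^+ 10) ^+ k = v ^+ l.
  by move=> <-; rewrite expr_mod ?exprM.
rewrite /alphaE (vX 1 10)%N // (vX 2 9)%N // (vX 3 8)%N // (vX 4 7)%N //.
rewrite (vX 5 6)%N // (vX 6 5)%N // (vX 7 4)%N // (vX 8 3)%N //.
rewrite (vX 9 2)%N // (vX 10 1)%N //.
by field; rewrite !np.
Qed.

Definition traces_elementary k v :=
  let S j := (mesym 5 F j).@[fun i : 'I_5 => trace_pow k (v ^+ (2 * i + 1))] in
  [/\ S 1 = -1, S 2 = -4, S 3 = 3, S 4 = 3 & S 5 = -1].

Lemma traces_elementary_prime v (zeta23 : F) M k :
    expsum v (iota 0 11) = 0 -> expsum zeta23 (iota 0 23) = 0 ->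
    M \in [pchar F] -> (M %% 253 = 232)%N -> (0 < k)%N -> M = (22 ^ k.+1).+1 ->
  traces_elementary k v.
Proof.
move=> Phi0 Phi23 pcharM M253 k_gt0 ME.
have res c : (0 < c < 11)%N ->
    trace_pow k (v ^+ c) = (v ^+ 2) ^+ c + (v ^+ 2) ^+ (10 * c).
  move=> c_bnd; rewrite /trace_pow.
  have N22 : (22 %| 22 ^ k)%N by rewrite dvdn_exp.
  have MN : M = (22 * 22 ^ k).+1 by rewrite -expnS.
  have Phic := Phi11X Phi0 c_bnd.
  rewrite !(alphaE_residue _ Phi23 pcharM) ?Phi11X //.
  by rewrite -!exprM; congr (_ ^+ _ + _ ^+ _); lia.
have [e1 e2 e3 e4 e5] := elementary_periods (Phi11X Phi0 (isT : 0 < 2 < 11)%N).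
rewrite /traces_elementary.
set w := fun i : 'I_5 => _.
have wE i : (i < 5)%N -> w (inord i) =
    (v ^+ 2) ^+ (2 * i + 1) + (v ^+ 2) ^+ (10 * (2 * i + 1)).
  by move=> i_lt; rewrite /w inordK // res //; lia.
by have [-> -> -> -> ->] := meval_mesym5 w; rewrite !wE.
Qed.

(** The symmetric functions force alpha^(22^k) to be a primitive 11th root of unity, so alpha^(2^k)
    has order exactly 11^(k+1). As alpha is fixed by the [q ^ 10]-th power map, that order divides
    q^10 - 1. *)
Lemma traces_elementary_order v q k :
    expsum v (iota 0 11) = 0 -> q \in [pchar F] -> 11 != 0 :> F ->
    23 != 0 :> F -> traces_elementary k v ->
  (11 ^ k.+1 %| q ^ 10 - 1)%N.
Proof.
move=> Phi0 pcharq nz11 nz23 [S1 S2 S3 S4 S5].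
have v11 := expsum_iota_root Phi0; have q_pr := pcharf_prime pcharq.
have xx' := alphaE_conj Phi0 nz23.
set x := alphaE v in xx'; set x' := alphaE _ in xx'.
have nz_x : x != 0.
  by apply: contraTneq (oner_neq0 F) => x0; rewrite -xx' x0 mul0r eqxx.
set y := x ^+ (22 ^ k); have nz_y : y != 0 := expf_neq0 _ nz_x.
have y11 : expsum y (iota 0 11) = 0.
  move: S1 S2 S3 S4 S5; set w := fun i : 'I_5 => _.
  have [-> -> -> -> ->] := meval_mesym5 w.
  have -> : w (inord 0) = y + y^-1.
    rewrite /w inordK // /trace_pow expr1 -/x -/x' -exprVn; congr (_ + _ ^+ _).
    by apply: (mulfI nz_x); rewrite xx' divff.
  move: (w _) (w _) (w _) (w _) => b c d e e1 e2 e3 e4 e5.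
  set t := y + y^-1 in e1 e2 e3 e4 e5.
  have t5 : t ^+ 5 + t ^+ 4 - 4 * t ^+ 3 - 3 * t ^+ 2 + 3 * t + 1 = 0.
    (* With the elementary symmetric functions of t, b, c, d, e for the [E]s, the right side is the
       monic quintic with these roots, evaluated at its root [t]. *)
    have monicE E1 E2 E3 E4 E5 : E1 = -1 -> E2 = -4 -> E3 = 3 -> E4 = 3 ->
        E5 = -1 -> t ^+ 5 + t ^+ 4 - 4 * t ^+ 3 - 3 * t ^+ 2 + 3 * t + 1 =
        t ^+ 5 - E1 * t ^+ 4 + E2 * t ^+ 3 - E3 * t ^+ 2 + E4 * t - E5.
      by do 5!move=> ->; ring.
    by rewrite (monicE _ _ _ _ _ e1 e2 e3 e4 e5); ring.
  have -> : expsum y (iota 0 11)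
      = y ^+ 5 * (t ^+ 5 + t ^+ 4 - 4 * t ^+ 3 - 3 * t ^+ 2 + 3 * t + 1).
    rewrite /expsum /= !big_cons big_nil /t.
    by field.
  by rewrite t5 mulr0.
have y_neq1 : y != 1.
  apply: contraNneq nz11 => y1; move: y11.
  rewrite y1 /expsum (eq_bigr (fun=> 1)) => [|i _]; last by rewrite expr1n.
  by rewrite big_const_seq count_predT size_iota iter_addr_0 => ->.
pose b := x ^+ (2 ^ k).
have b11k : b ^+ (11 ^ k) = y by rewrite -exprM -expnMn.
have b11 : b ^+ (11 ^ k.+1) = 1.
  by rewrite expnSr exprM b11k (expsum_iota_root y11).
have q_gt0 := prime_gt0 q_pr.
have co_q11 : coprime q 11.
  rewrite coprime_sym prime_coprime // dvdn_prime2 //.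
  by apply: contraNneq nz11 => ->; rewrite -(dvdn_pcharf pcharq).
(* Euler's theorem: [q ^ 10] is 1 modulo 11. *)
have vq : v ^+ (q ^ 10) = v.
  have := Euler_exp_totient co_q11.
  by rewrite -(expr_mod _ v11) => ->; rewrite expr1.
have xq : x ^+ (q ^ 10) = x.
  have piEX c j : piE (v ^+ c) ^+ (q ^ j) = piE ((v ^+ (q ^ j)) ^+ c).
    elim: j => [|j IHj]; first by rewrite expr1.
    rewrite expnSr exprM IHj (expsum_Frobenius pcharq) -expsumX.
    by rewrite -!exprM; congr (expsum (_ ^+ _) _); lia.
  have piEq c : piE (v ^+ c) ^+ (q ^ 10) = piE (v ^+ c) by rewrite piEX vq.
  rewrite /x /alphaE; set Q := (q ^ 10)%N in piEq *.
  have fX (t : F) j : (t ^+ j) ^+ Q = (t ^+ Q) ^+ j by rewrite exprAC.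
  have fD (t s : F) : (t / s) ^+ Q = t ^+ Q / s ^+ Q by rewrite expr_div_n.
  by rewrite !(fX, fD, exprMn Q) !piEq.
have bq : b ^+ (q ^ 10 - 1) = 1.
  rewrite /b exprAC; suff -> : x ^+ (q ^ 10 - 1) = 1 by rewrite expr1n.
  apply: (mulfI nz_x).
  by rewrite mulr1 -exprS subn1 prednK ?xq // expn_gt0 q_gt0.
have [|m prim_m] := prim_order_exists _ b11; first by rewrite expn_gt0.
case/(dvdn_pfactor _ _ (isT : prime 11)) => j j_le mE.
(* An order dividing 11^k would give y = 1. *)
have [jk | kj] := leqP j k.
  case/eqP: y_neq1; rewrite -b11k; apply/eqP.
  by rewrite -(prim_order_dvd prim_m) mE dvdn_exp2l.
have -> : (11 ^ k.+1)%N = m by rewrite mE; congr (_ ^ _)%N; lia.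
by rewrite (prim_order_dvd prim_m) bq.
Qed.

End Residues.

(** * Transfer of integer relations from characteristic zero to residue fields *)

Lemma Cyclotomic11E : Cyclotomic 11 = \sum_(i < 11) 'X^i.
Proof.
have Phi1 : Cyclotomic 1 = 'X - 1.
  by rewrite -['X]expr1 -(prod_Cyclotomic (isT : 0 < 1)%N) big_seq1.
have := prod_Cyclotomic (isT : 0 < 11)%N.
rewrite (_ : divisors 11 = [:: 1; 11]%N) // big_cons big_seq1 Phi1 subrX1.
apply: mulfI; rewrite -[1]/(1%:P); exact/monic_neq0/monicXsubC.
Qed.

(** Division by the monic cyclotomic polynomial leaves an integer remainder of degree below 10
    vanishing at [w]. The minimal polynomial of [w] has degree 10, so the remainder is zero and the
    relation holds at every root. *)
Lemma int_relation_at_root (w : algC) (K : comNzRingType) (u : K) (Q : {poly int}) :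
    11.-primitive_root w -> expsum u (iota 0 11) = 0 ->
    (map_poly intr Q).[w] = 0 -> (map_poly intr Q).[u] = 0.
Proof.
move=> prim_w Phi0 Qw0; have mon := Cyclotomic_monic 11.
have Phi_u : (map_poly intr (Cyclotomic 11)).[u] = 0.
  rewrite Cyclotomic11E rmorph_sum horner_sum -[RHS]Phi0 /expsum.
  rewrite -[iota _ _]/(index_iota 0 11) big_mkord; apply: eq_bigr => i _.
  by rewrite /= map_polyXn hornerXn.
have Phi_w : (map_poly intr (Cyclotomic 11)).[w] = 0.
  by rewrite (Cintr_Cyclotomic prim_w); apply/rootP; rewrite root_cyclotomic.
have := Pdiv.RingMonic.rdivp_eq mon Q.
set D := Pdiv.Ring.rdivp _ _; set R := Pdiv.Ring.rmodp _ _ => QE.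
have sz_R : (size R < 11)%N.
  have := Pdiv.Ring.ltn_rmodpN0 Q (monic_neq0 mon).
  by rewrite size_Cyclotomic.
suff R0 : R = 0 by rewrite QE R0 addr0 rmorphM hornerM Phi_u mulr0.
have Rw0 : (map_poly intr R).[w] = 0.
  by rewrite QE rmorphD rmorphM hornerD hornerM Phi_w mulr0 add0r in Qw0.
have [p [pE mon_p] dv_p] := minCpolyP w.
have : p %| map_poly intr R.
  rewrite -dv_p; apply/rootP; rewrite -Rw0 -map_poly_comp.
  by congr (_.[_]); apply: eq_map_poly => a /=; rewrite ratr_int.
have sz_p : size p = 11%N.
  have := congr1 (fun p : {poly algC} => size p) pE.
  by rewrite (minCpoly_cyclotomic prim_w) size_cyclotomic size_map_poly.
have sz_mR : size (map_poly intr R : {poly rat}) = size R.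
  by apply: size_map_inj_poly => //; apply: intr_inj.
move=> dvR; apply/eqP; rewrite -size_poly_eq0 -sz_mR size_poly_eq0.
apply: contraLR sz_R => nzR; rewrite -leqNgt -sz_mR -sz_p.
exact: dvdp_leq.
Qed.

Lemma prim_root11 (F : fieldType) (v : F) :
  expsum v (iota 0 11) = 0 -> 11 != 0 :> F -> 11.-primitive_root v.
Proof.
move=> Phi0 nz11; have v11 := expsum_iota_root Phi0.
have [m prim_m] := prim_order_exists (isT : 0 < 11)%N v11.
have [_ dvd11] := primeP (isT : prime 11).
case/dvd11/orP => /eqP mE; last by rewrite -mE.
have /eqP := prim_expr_order prim_m; rewrite mE expr1 => /eqP v1.
case/eqP: nz11; rewrite -Phi0 v1 /expsum (eq_bigr (fun=> 1)); last first.
  by move=> i _; rewrite expr1n.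
by rewrite big_const_seq count_predT size_iota iter_addr_0.
Qed.

Section Specialization.
Variables (L K : fieldType) (w : L) (u : K).
Hypothesis Phi11_w : expsum w (iota 0 11) = 0.
Hypothesis Phi11_u : expsum u (iota 0 11) = 0.
Hypothesis nz23 : 23 != 0 :> K.
Variable f : {rmorphism L -> algC}.

(* The ring morphism Z[w, 1/23] -> K sending w to u, as a relation. *)
Definition specializes (x : L) (y : K) := exists (P : {poly int}) (e : nat),
  x * 23 ^+ e = (map_poly intr P).[w] /\ y * 23 ^+ e = (map_poly intr P).[u].

Let intL_eq0 (a : int) : (a%:~R == 0 :> L) = (a == 0).
Proof. by rewrite -(fmorph_eq0 f) rmorph_int intr_eq0. Qed.

Let L23 : 23 != 0 :> L.
Proof. by rewrite (intL_eq0 23). Qed.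

(** This is what makes specialization well defined; [f] carries the relation into [algC]. *)
Let relations (Q : {poly int}) :
  (map_poly intr Q).[w] = 0 -> (map_poly intr Q).[u] = 0.
Proof.
move=> Qw0; apply: (@int_relation_at_root (f w)) => //.
  by rewrite fmorph_primitive_root prim_root11 // (intL_eq0 11).
rewrite -(rmorph0 f) -Qw0 -horner_map -map_poly_comp.
by congr (_.[_]); apply: eq_map_poly => a; rewrite /= rmorph_int.
Qed.

Lemma specializesM x1 x2 y1 y2 : specializes x1 y1 -> specializes x2 y2 ->
  specializes (x1 * x2) (y1 * y2).
Proof.
move=> [P1 [e1 [x1E y1E]]] [P2 [e2 [x2E y2E]]].
exists (P1 * P2), (e1 + e2)%N.
by rewrite !rmorphM !hornerM -x1E -x2E -y1E -y2E !exprD; split; ring.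
Qed.

Lemma specializesD x1 x2 y1 y2 : specializes x1 y1 -> specializes x2 y2 ->
  specializes (x1 + x2) (y1 + y2).
Proof.
move=> [P1 [e1 [x1E y1E]]] [P2 [e2 [x2E y2E]]].
exists (P1 * (23 ^+ e2)%:P + P2 * (23 ^+ e1)%:P), (e1 + e2)%N.
rewrite !rmorphD !rmorphM /= !map_polyC /= !hornerD !hornerM !hornerC.
rewrite -x1E -x2E -y1E -y2E !rmorphXn /= !exprD.
by split; ring.
Qed.

Lemma specializes_int (a : int) : specializes a%:~R a%:~R.
Proof. by exists a%:P, 0%N; rewrite !map_polyC /= !hornerC !mulr1. Qed.

Lemma specializesX x y k : specializes x y -> specializes (x ^+ k) (y ^+ k).
Proof.
move=> xy; elim: k => [|k IHk]; first exact: (specializes_int 1).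
by rewrite !exprS; apply: specializesM.
Qed.

Lemma specializes_expsum c s :
  specializes (expsum (w ^+ c) s) (expsum (u ^+ c) s).
Proof.
exists (\sum_(i <- s) 'X^(c * i)), 0%N; rewrite !mulr1 !rmorph_sum !horner_sum.
by split; apply: eq_bigr => i _; rewrite /= map_polyXn hornerXn exprM.
Qed.

(** Inverting 23 inverts every conjugate of pi: the cofactor is the product of the other nine. *)
Let piE_inverse (R : comNzRingType) (v : R) c :
    expsum v (iota 0 11) = 0 -> (0 < c < 11)%N ->
  piE (v ^+ c) * \prod_(d <- rem c (iota 1 10)) piE (v ^+ d) = 23.
Proof.
move=> Phi0 c_bnd; rewrite -(piE_norm Phi0).
transitivity (\prod_(d <- iota 1 10) piE (v ^+ d)).
  by rewrite [RHS](big_rem c) ?mem_iota.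
by rewrite /= !big_cons big_nil expr1; ring.
Qed.

Lemma specializes_piEV c : (0 < c < 11)%N ->
  specializes (piE (w ^+ c))^-1 (piE (u ^+ c))^-1.
Proof.
move=> c_bnd.
have [P [e [zE z'E]]] : specializes
    (\prod_(d <- rem c (iota 1 10)) piE (w ^+ d))
    (\prod_(d <- rem c (iota 1 10)) piE (u ^+ d)).
  apply: (big_ind2 specializes); first exact: (specializes_int 1).
    by move=> *; apply: specializesM.
  by move=> d _; apply: specializes_expsum.
exists P, e.+1; rewrite !exprS -zE -z'E.
rewrite -[X in X * _ ^+ e](piE_inverse Phi11_w c_bnd).
rewrite -[X in _ /\ _ * (X * _ ^+ e) = _](piE_inverse Phi11_u c_bnd).
by rewrite !mulrA !mulVf ?mul1r // piE_neq0.
Qed.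

Lemma specializes_alphaE c : (0 < c < 11)%N ->
  specializes (alphaE (w ^+ c)) (alphaE (u ^+ c)).
Proof.
move=> c_bnd.
have piE_spec d : specializes (piE (w ^+ c ^+ d)) (piE (u ^+ c ^+ d)).
  by rewrite -!exprM; apply: specializes_expsum.
have piEV_spec d : (0 < d < 11)%N ->
    specializes (piE (w ^+ c ^+ d))^-1 (piE (u ^+ c ^+ d))^-1.
  move=> d_bnd; rewrite -!exprM.
  rewrite -(expr_mod _ (expsum_iota_root Phi11_w)).
  rewrite -(expr_mod _ (expsum_iota_root Phi11_u)).
  apply: specializes_piEV; rewrite ltn_pmod // andbT lt0n -/(_ %| _)%N.
  rewrite Euclid_dvdM // negb_or.
  by apply/andP; split; apply/negP => /dvdn_leq; lia.
by rewrite /alphaE; do ?[exact: piE_spec | exact: piEV_spec |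
  apply: specializesX | apply: specializesM].
Qed.

Lemma specializes_mesym5 j k :
  specializes (mesym 5 L j).@[fun i => trace_pow k (w ^+ (2 * i + 1))]
    (mesym 5 K j).@[fun i => trace_pow k (u ^+ (2 * i + 1))].
Proof.
rewrite /mesym !rmorph_sum /=; apply: (big_ind2 specializes).
- exact: (specializes_int 0).
- by move=> *; apply: specializesD.
move=> h _; rewrite !rmorph_prod /=; apply: (big_ind2 specializes).
- exact: (specializes_int 1).
- by move=> *; apply: specializesM.
move=> i _; rewrite !mevalXU /trace_pow.
have i_bnd : (0 < 2 * i + 1 < 11)%N by have := ltn_ord i; lia.
have spec10 : specializes (alphaE ((w ^+ (2 * i + 1)) ^+ 10))
    (alphaE ((u ^+ (2 * i + 1)) ^+ 10)).
  rewrite -!exprM.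
  rewrite -(expr_mod _ (expsum_iota_root Phi11_w)).
  rewrite -(expr_mod _ (expsum_iota_root Phi11_u)).
  by apply: specializes_alphaE; have := ltn_ord i; lia.
by apply: specializesD; apply: specializesX => //; apply: specializes_alphaE.
Qed.

(** Stated without division, since the denominator of [a] may vanish in [K]. *)
Lemma specializes_rat (a : rat) y : specializes (ratr a) y ->
  (numq a)%:~R = (denq a)%:~R * y.
Proof.
move=> [P [e [aE yE]]].
have evE (R : comNzRingType) (v : R) (m d : int) :
    (map_poly intr (m%:P - d%:P * P)).[v]
    = m%:~R - d%:~R * (map_poly intr P).[v].
  by rewrite rmorphB rmorphM /= !map_polyC hornerD hornerN hornerM !hornerC.
have nz_d : (denq a)%:~R != 0 :> L by rewrite intL_eq0 denq_eq0.
have := @relations ((numq a * 23 ^+ e)%:P - (denq a)%:P * P).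
rewrite !evE -aE -yE !rmorphM !rmorphXn /= /ratr mulrA mulrCA divff //.
rewrite mulr1 subrr => /(_ erefl).
by move/eqP; rewrite mulrA -mulrBl mulf_eq0 expf_eq0 (negPf nz23) andbF orbF
  subr_eq0 => /eqP.
Qed.

End Specialization.

(** Denominators prime to [M] are nonzero in characteristic [q], so the congruence can be cleared of
    them and reduced modulo [q]. *)
Lemma eqmodQ_residue (L : splittingFieldType rat) (K : fieldType) (M q : nat)
    (x : L) (y : K) (c : int) :
    q \in [pchar K] -> (q %| M)%N ->
    (forall a, x = ratr a -> (numq a)%:~R = (denq a)%:~R * y) ->
  eqmodQ M x c%:~R -> y = c%:~R.
Proof.
move=> pcharq q_M spec [a [b [xE cE co_a _ [e co_e abE]]]].
have bE : b = c%:~R.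
  apply: (fmorph_inj (in_alg L)).
  by rewrite (fmorph_eq_rat (in_alg L)) -cE rmorph_int.
have den_neq0 (d : rat) : prime_to_denq M d -> (denq d)%:~R != 0 :> K.
  move=> co_d; rewrite -(dvdz_pcharf pcharq) -/(_ \in _) dvdzE /=.
  rewrite -prime_coprime ?(pcharf_prime pcharq) // coprime_sym.
  exact: coprime_dvdr q_M co_d.
have nz_a := den_neq0 _ co_a; have nz_e := den_neq0 _ co_e.
have intE : numq a * denq e - c * denq a * denq e = M%:Z * numq e * denq a.
  apply: (@intr_inj rat); rewrite rmorphB !rmorphM /=.
  rewrite !numqE -bE -[(M%:Z)%:~R]/(M%:R).
  by rewrite mulrA -abE; ring.
have M0 : M%:R = 0 :> K by apply/eqP; rewrite -(dvdn_pcharf pcharq).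
have := congr1 (fun m : int => m%:~R : K) intE.
rewrite /= rmorphB !rmorphM /= (spec a xE) -[(M%:Z)%:~R]/(M%:R) M0 !mul0r.
move/eqP; rewrite subr_eq0 => /eqP /(mulIf nz_e).
by rewrite mulrC => /(mulIf nz_a).
Qed.

(** If [M] divided the denominator of [a], the relation in [K] would make it divide the numerator as
    well. *)
Lemma residue_eqmodQ (L : splittingFieldType rat) (K : fieldType) (M : nat)
    (x : L) (a : rat) (c : int) :
    M \in [pchar K] -> x = ratr a ->
    (numq a)%:~R = (denq a)%:~R * c%:~R :> K ->
  eqmodQ M x c%:~R.
Proof.
move=> pcharM xE numE; have M_pr := pcharf_prime pcharM.
have dvdK (m : int) : (M %| m)%Z = (m%:~R == 0 :> K) by exact: (dvdz_pcharf pcharM).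
have co_a : prime_to_denq M a.
  rewrite /prime_to_denq coprime_sym prime_coprime //; apply/negP => M_d.
  have d0 : (denq a)%:~R = 0 :> K by apply/eqP; rewrite -dvdK dvdzE.
  have M_n : (M %| `|numq a|)%N.
    by have := dvdK (numq a); rewrite numE d0 mul0r eqxx dvdzE.
  have := coprime_num_den a; rewrite /coprime => /eqP co.
  have : (M %| 1)%N by rewrite -co dvdn_gcd M_n.
  by rewrite dvdn1 => /eqP M1; rewrite M1 in M_pr.
have /dvdzP[t tE] : (M %| numq a - c * denq a)%Z.
  by rewrite dvdK rmorphB rmorphM /= numE mulrC subrr.
exists a, c%:~R; split=> //.
- by rewrite ratr_int.
- by rewrite /prime_to_denq denq_int coprime1n.
have nza : (denq a)%:~R != 0 :> rat by rewrite intr_eq0 denq_eq0.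
exists (t%:~R / (denq a)%:~R); last first.
  have := congr1 (fun m : int => m%:~R : rat) tE; rewrite rmorphB !rmorphM /= => tE'.
  apply: (mulIf nza); rewrite -mulrA divfK // mulrBl -numqE.
  by rewrite tE' mulrC.
(* The denominator of [e] divides that of [a], hence is prime to [M]. *)
set e := _ / _; apply: coprime_dvdl co_a.
have eE : numq e * denq a = t * denq e.
  apply: (@intr_inj rat); rewrite !rmorphM /= numqE /e.
  by rewrite mulrAC divfK.
have : (denq e %| numq e * denq a)%Z by rewrite eE dvdz_mull.
rewrite Gauss_dvdzr ?dvdzE //.
by rewrite coprimezE coprime_sym coprime_num_den.
Qed.

(** * The complex root of unity [zeta 22] *)

Lemma norm_root11 (w : algC) : w ^+ 11 = 1 -> `|w| = 1.
Proof.
by move=> w11; apply/eqP; rewrite -(@pexpr_eq1 _ _ 11) // -normrX w11 normr1.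
Qed.

(** The square of [zeta 22] is clearly an 11th root of unity. That it is not 1 rests on the choice
    of [22.-root], which has the largest real part among the roots with nonnegative imaginary
    part. *)
Lemma Phi11_zeta22 : expsum (zeta 22 ^+ 2) (iota 0 11) = 0.
Proof.
set y := 22.-root (-1 : algC); have y22 : y ^+ 22 = -1 by rewrite rootCK.
set w := zeta 22 ^+ 2; have wE : w = y ^+ 4 by rewrite /w /zeta -exprM.
have w11 : w ^+ 11 = 1 by rewrite wE -exprM (exprM y 22 2) y22 sqrrN expr1n.
have w_neq1 : w != 1.
  apply/eqP; rewrite wE => y4.
  have y2 : y ^+ 2 = -1 by rewrite -y22 (exprD y 20 2) (exprM y 4 5) y4 expr1n mul1r.
  have Re_y : 'Re y = 0.
    have : (y - 'i) * (y + 'i) = 0.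
      by rewrite -subr_sqr y2 sqrCi subrr.
    move/eqP; rewrite mulf_eq0 subr_eq0 addr_eq0 => /orP[] /eqP ->.
      by rewrite Re_i.
    by rewrite raddfN /= Re_i oppr0.
  (* If y were one of the primitive 4th roots of unity, then up to sign and
     conjugation 'i * e would be a root of -1 with larger real part. *)
  have [e prim_e] := C_prim_root_exists (isT : 0 < 11)%N.
  have Re_max (x : algC) : x ^+ 22 = -1 -> 0 <= 'Im x -> 'Re x <= 0.
    by move=> x22 Im_x; rewrite -Re_y; apply: rootC_Re_max.
  have e11 := prim_expr_order prim_e.
  pose x := 'i * e.
  have i22 : 'i ^+ 22 = -1 :> algC.
    by rewrite (exprM _ 2 11) sqrCi -signr_odd.
  have x22 : x ^+ 22 = -1 by rewrite exprMn (exprM e 11 2) e11 expr1n mulr1.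
  have conj22 (t : algC) : t ^+ 22 = -1 -> t^* ^+ 22 = -1.
    by move=> t22; rewrite -rmorphXn t22 rmorphN rmorph1.
  have opp22 (t : algC) : t ^+ 22 = -1 -> (- t) ^+ 22 = -1.
    by move=> t22; rewrite exprNn t22 -signr_odd mul1r.
  have Re_x : 'Re x = 0.
    have le0 (t : algC) : t ^+ 22 = -1 -> 'Re t <= 0.
      move=> t22; have /orP[] : (0 <= 'Im t) || ('Im t <= 0).
      - by rewrite -realE Creal_Im.
      - exact: Re_max.
      rewrite -oppr_ge0 -Im_conj => It; rewrite -Re_conj.
      by apply: Re_max => //; apply: conj22.
    apply/eqP; rewrite eq_le le0 //= -oppr_le0.
    by have := le0 _ (opp22 _ x22); rewrite raddfN.
  have Im_e : 'Im e = 0 by apply: oppr_inj; rewrite -ReMil Re_x oppr0.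
  have e_real : e \is Num.real by apply/Creal_ImP.
  have e2 : e ^+ 2 = 1 by rewrite -(real_normK e_real) (norm_root11 e11) expr1n.
  have := prim_order_dvd prim_e 1.
  by rewrite expr1 -{1}e11 (exprS e 10) (exprM e 2 5) e2 expr1n mulr1 eqxx.
apply: (mulfI (_ : w - 1 != 0)); first by rewrite subr_eq0.
rewrite mulr0 /expsum -[iota _ _]/(index_iota 0 11) big_mkord.
by rewrite -subrX1 w11 subrr.
Qed.

(** * Ring morphisms, group ring exponents and fixed elements *)

Lemma rmorph_expsum (R S : comNzRingType) (f : {rmorphism R -> S}) v s :
  f (expsum v s) = expsum (f v) s.
Proof. by rewrite rmorph_sum; apply: eq_bigr => i _; rewrite rmorphXn. Qed.

Lemma rmorph_piEX (R S : comNzRingType) (f : {rmorphism R -> S}) v c :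
  f (piE (v ^+ c)) = piE (f v ^+ c).
Proof. by rewrite /piE rmorph_expsum rmorphXn. Qed.

Lemma rmorph_alphaE (F E : fieldType) (f : {rmorphism F -> E}) v :
  f (alphaE v) = alphaE (f v).
Proof.
by rewrite /alphaE !(rmorphM, rmorphXn, fmorphV) /= !rmorph_piEX.
Qed.

Lemma rmorph_trace_pow (F E : fieldType) (f : {rmorphism F -> E}) k v :
  f (trace_pow k v) = trace_pow k (f v).
Proof. by rewrite rmorphD !rmorphXn /= !rmorph_alphaE rmorphXn. Qed.

Lemma conj_root11 (w : algC) : w ^+ 11 = 1 -> w^* = w ^+ 10.
Proof.
move=> w11; have nz_w : w != 0.
  by apply: contraTneq (oner_neq0 algC) => w0; rewrite -w11 w0 expr0n eqxx.
by apply: (mulfI nz_w); rewrite -normCK (norm_root11 w11) expr1n -exprS w11.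
Qed.

Lemma galpowD (L : splittingFieldType rat) (x : L) (s t : intGalRing L) :
  x != 0 -> galpow x (s + t) = galpow x s * galpow x t.
Proof.
move=> nz_x; rewrite /galpow -big_split; apply: eq_bigr => g _ /=.
by rewrite ffunE expfzDr // fmorph_eq0.
Qed.

Lemma galpowMn (L : splittingFieldType rat) (x : L) (s : intGalRing L) k :
  x != 0 -> galpow x (s *+ k) = galpow x s ^+ k.
Proof.
move=> nz_x; elim: k => [|k IHk].
  by rewrite /galpow big1 // => g _; rewrite ffunE.
by rewrite mulrS galpowD // IHk exprS.
Qed.

Lemma galpow_of (L : splittingFieldType rat) (x : L) (s : gal_of {:L}) :
  galpow x (galring_of s) = s x.
Proof.
rewrite /galpow (bigD1 s) /=; last first.
  by rewrite gal_kAut ?sub1v // kAut1E limg_gal.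
rewrite ffunE eqxx big1 ?mulr1 ?expr1z // => t /andP[_ /negbTE t_s].
by rewrite ffunE t_s.
Qed.

Lemma fixed_rational (L : splittingFieldType rat) (x : L) :
  (forall s : gal_of {:L}, s x = x) -> exists a : rat, x = ratr a.
Proof.
move=> fix_x; have L0 : [pchar L] =i pred0.
  by move=> p; rewrite (fmorph_pchar (in_alg L)) pchar_num.
have galL : galois 1 {:L}.
  rewrite /galois sub1v normalFieldf andbT.
  by apply/separableP => t _; apply: pcharf0_separable.
have : x \in fixedField 'Gal({:L} / 1%AS)%g.
  by apply/fixedFieldP; rewrite ?memvf.
rewrite (galois_fixedField galL) => /vlineP[a ->].
by exists a; rewrite -(fmorph_eq_rat (in_alg L)).
Qed.

(** * The numbers [S_] as values at zeta_11, and their rationality *)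

Section Zeta22Field.
Variables (L : splittingFieldType rat) (iota : {rmorphism L -> algC}) (z : L).
Hypothesis iota_z : iota z = zeta 22.
Variable bar : L -> L.
Hypothesis barE : forall x : L, iota (bar x) = (iota x)^*.
Variable sigma : int -> gal_of {:L}.
Hypothesis sigmaE : forall c : int, coprimez c 22 -> sigma c z = z ^ c.

Let w := z ^+ 2.

Lemma Phi11_zsqr : expsum w (seq.iota 0 11) = 0.
Proof.
apply: (fmorph_inj iota).
by rewrite rmorph_expsum rmorphXn iota_z Phi11_zeta22 rmorph0.
Qed.

Let w11 : w ^+ 11 = 1 := expsum_iota_root Phi11_zsqr.

Let nz23 : 23 != 0 :> L.
Proof. by rewrite -(fmorph_eq0 iota) rmorph_nat pnatr_eq0. Qed.

Let iota_w11 : iota w ^+ 11 = 1.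
Proof. by rewrite -rmorphXn w11 rmorph1. Qed.

Let sigma_w c d : coprimez c 22 -> (c = d%:Z %[mod 11])%Z -> sigma c w = w ^+ d.
Proof.
move=> co_c /eqP; rewrite eqz_mod_dvd => /dvdzP[t c_d].
have nz_w : w != 0.
  by apply: contraTneq (oner_neq0 L) => w0; rewrite -w11 w0 expr0n eqxx.
rewrite /w rmorphXn /= (sigmaE co_c) exprnP exprzAC -exprnP -/w.
rewrite (_ : c = 11%:Z * t + d%:Z); last by lia.
by rewrite expfzDr // -exprz_exp -exprnP w11 exp1rz mul1r.
Qed.

Let bar_piL : bar (piL z) = piE (w ^+ 10).
Proof.
have -> : piL z = piE w.
  by rewrite /piL /piE /expsum !big_cons big_nil addr0 addrA.
apply: (fmorph_inj iota); rewrite barE !(rmorph_expsum iota).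
by rewrite (rmorph_expsum Num.conj) /= (conj_root11 iota_w11) (rmorphXn iota 10).
Qed.

Lemma alpha_alphaE : alpha z bar sigma = alphaE w.
Proof.
have piLE : piL z = piE (w ^+ 1).
  by rewrite /piL /piE /expsum !big_cons big_nil addr0 addrA expr1.
have np c := @piE_neq0 L w c Phi11_zsqr nz23.
rewrite /alpha bar_piL piLE; set x := _ / _.
have nz_x : x != 0 by rewrite /x mulf_neq0 ?invr_eq0 ?np.
have sx c d e : coprimez c 22 -> (c = d%:Z %[mod 11])%Z -> (d * 10 %% 11 = e)%N ->
    sigma c x = piE (w ^+ d) / piE (w ^+ e).
  move=> co_c c_d <-; rewrite /x rmorphM fmorphV /= !rmorph_piEX /=.
  by rewrite (sigma_w co_c c_d) expr1 (expr_mod _ w11) exprM.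
rewrite /tau 4!(galpowD _ _ nz_x) 4!(galpowMn _ _ nz_x) !galpow_of.
rewrite (sx 1 1%N 10%N) // (sx (-7) 4%N 7%N) // (sx 9 9%N 2%N) //.
by rewrite (sx (-3) 8%N 3%N) // (sx 5 5%N 6%N).
Qed.

Let bar_alphaE : bar (alphaE w) = alphaE (w ^+ 10).
Proof.
apply: (fmorph_inj iota); rewrite barE !(rmorph_alphaE iota).
by rewrite (rmorph_alphaE Num.conj) /= conj_root11 // (rmorphXn iota 10).
Qed.

Lemma S_traceE k j :
  S_ z bar sigma k j = (mesym 5 L j).@[fun i => trace_pow k (w ^+ (2 * i + 1))].
Proof.
apply: meval_eq => i; rewrite /alpha_ /alpha1 alpha_alphaE bar_alphaE.
rewrite -/(trace_pow k w).
have [-> | nz_i] := eqVneq i ord0; first by rewrite expr1.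
rewrite (rmorph_trace_pow (sigma _)) /= (sigma_w (d := 2 * i + 1)) //.
  by case: i nz_i => [[|[|[|[|[|i]]]]] lt_i].
by congr (modz (Posz _) _); lia.
Qed.

(** Every automorphism sends [w] to some [w ^+ c] and therefore permutes the five traces, so it
    fixes their symmetric functions. *)
Lemma mesym_trace_rational k j : (0 < j < 6)%N -> exists a : rat,
  (mesym 5 L j).@[fun i => trace_pow k (w ^+ (2 * i + 1))] = ratr a.
Proof.
move=> j_bnd; apply: fixed_rational => s.
pose T m := trace_pow k (w ^+ m).
(* Conjugation exchanges m and 11 - m, so odd representatives suffice. *)
pose rep m := (if odd (m %% 11) then m %% 11 else 11 - m %% 11)%N.
have T_rep m : T m = T (rep m).
  rewrite /T /rep -(expr_mod m w11); case: ifP => // even_m.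
  have w_eq a b : a = b %[mod 11] -> w ^+ a = w ^+ b.
    by move=> ab; rewrite -(expr_mod a w11) ab (expr_mod b w11).
  rewrite /trace_pow addrC -!(exprM w).
  by congr (alphaE _ ^+ _ + alphaE _ ^+ _); apply: w_eq; lia.
have sw11 : (s w) ^+ 11 = 1 by rewrite -rmorphXn w11 rmorph1.
have nz11 : 11 != 0 :> L by rewrite -(fmorph_eq0 iota) rmorph_nat pnatr_eq0.
have prim_w := prim_root11 Phi11_zsqr nz11.
have [c sw] := prim_rootP prim_w sw11.
have c_bnd : (0 < c < 11)%N.
  rewrite ltn_ord andbT lt0n; apply/eqP => c0; move/eqP: sw.
  rewrite c0 expr0 fmorph_eq1 -[w]expr1 -(prim_order_dvd prim_w).
  by [].
have sT m : s (T m) = T (c * m)%N.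
  by rewrite (rmorph_trace_pow s) /T exprM -sw; congr trace_pow; apply: rmorphXn.
set v := fun i : 'I_5 => _.
have vE i : (i < 5)%N -> v (inord i) = T (2 * i + 1)%N.
  by move=> i_lt; rewrite /v inordK.
have := meval_mesym5 v; rewrite !vE // => -[S1 S2 S3 S4 S5].
have repr m : T (c * m)%N = T (rep (c * m)%N) by apply: T_rep.
(* What remains is finite: for each of the five [j] and ten [c], the terms T 1, T 3, T 5, T 7, T 9
   are permuted. *)
clearbody T; move: c_bnd repr sT; case: (c) => {c sw} c _ /= c_bnd repr sT.
move: j j_bnd; do 6?[case=> //]; move=> _; rewrite ?(S1, S2, S3, S4, S5);
  rewrite !(rmorphD, rmorphM) /= !sT !repr; clear -c_bnd;
  move: c c_bnd; do 11?[case=> //]; move=> _;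
  repeat match goal with
  | |- context [rep ?m] => let r := eval compute in (rep m) in change (rep m) with r
  end; ring.
Qed.

End Zeta22Field.

(** * Residue fields and the primality criterion *)

Lemma exists_roots_pchar q : prime q ->
  exists (K : fieldType) (u zeta23 : K),
    [/\ q \in [pchar K], expsum u (iota 0 11) = 0
      & expsum zeta23 (iota 0 23) = 0].
Proof.
move=> q_pr.
have [K [f _]] := countable_algebraic_closure 'F_q.
have Phi_root m : (1 < m)%N -> exists v : K, expsum v (iota 0 m) = 0.
  move=> m_gt1; have [|v /eqP v0] := closed_rootP (\poly_(i < m) (1 : K)) _.
    by rewrite size_poly_eq ?oner_eq0 // -(subnKC m_gt1).
  exists v; rewrite -[RHS]v0 horner_poly /expsum.
  rewrite -{1}(subn0 m) -[iota _ _]/(index_iota 0 m) big_mkord.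
  by apply: eq_bigr => i _; rewrite mul1r.
have [u u0] := Phi_root 11%N isT; have [z z0] := Phi_root 23%N isT.
by exists K, u, z; split=> //; rewrite (fmorph_pchar f) pchar_Fp.
Qed.

(** 22^2 is 0 modulo 11 and 1 modulo 23, hence an idempotent, namely 231, modulo 253. *)
Lemma pow22_mod253 n : (0 < n)%N -> ((22 ^ (2 ^ n) + 1) %% 253 = 232)%N.
Proof.
case: n => // n _; rewrite expnS expnM.
have idem t : ((22 ^ 2) ^ t.+1 = 231 %[mod 253])%N.
  elim: t => // t IHt; rewrite expnS -modnMmr IHt modnMmr.
  by vm_compute.
have /prednK <- : (0 < 2 ^ n)%N by rewrite expn_gt0.
by rewrite -modnDml idem.
Qed.

Theorem proposition4p4
    (L : splittingFieldType rat) (iota : {rmorphism L -> algC}) (z : L)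
    (iota_z : iota z = zeta 22) (genL : <<1; z>>%VS = fullv)
    (bar : L -> L) (barE : forall x : L, iota (bar x) = (iota x)^*)
    (sigma : int -> gal_of {:L})
    (sigmaE : forall c : int, coprimez c 22 -> sigma c z = z ^ c)
    (n r M : nat) (n_ge1 : (1 <= n)%N) (rE : r = (2 ^ n)%N)
    (ME : M = (22 ^ (2 ^ n) + 1)%N)
    (no_divisor : forall x : nat, (1 < x < 11 ^ r)%N ->
       x ^ 10 = 1 %[mod 11 ^ r] -> ~~ (x %| M)%N) :
  prime M <->
  [/\ eqmodQ M (S_ z bar sigma r.-1 1) (-1),
      eqmodQ M (S_ z bar sigma r.-1 2) (-4),
      eqmodQ M (S_ z bar sigma r.-1 3) 3,
      eqmodQ M (S_ z bar sigma r.-1 4) 3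
    & eqmodQ M (S_ z bar sigma r.-1 5) (-1)].
Proof.
have M253 : (M %% 253 = 232)%N by rewrite ME pow22_mod253.
have r_gt1 : (1 < r)%N by rewrite rE -(prednK n_ge1) expnS leq_pmulr ?expn_gt0.
have MEr : M = (22 ^ r.-1.+1).+1 by rewrite prednK ?(ltnW r_gt1) // rE ME addn1.
have Phi11_w := Phi11_zsqr iota_z.
set w := z ^+ 2 in Phi11_w.
have lit (R : pzRingType) :
    [/\ -1 = (-1)%:~R :> R, -4 = (-4)%:~R :> R & 3 = 3%:~R :> R] by rewrite !mulrNz.
have [L1 L4 L3] := lit L.
(* Neither 11 nor 23 divides [M], because 232 is prime to 253. *)
have nz_pchar (K : fieldType) q p : q \in [pchar K] -> (q %| M)%N -> prime p ->
    (p %| 253)%N -> p%:R != 0 :> K.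
  move=> pcharq q_M p_pr p253; rewrite -(dvdn_pcharf pcharq).
  apply: contraL q_M; rewrite dvdn_prime2 ?(pcharf_prime pcharq) // => /eqP ->.
  rewrite /dvdn -(modn_dvdm _ p253) M253 -/(dvdn _ _).
  apply/negP => p232; have : (p %| gcdn 253 232)%N by rewrite dvdn_gcd p253.
  by rewrite (_ : gcdn 253 232 = 1)%N // dvdn1 => /eqP p1; rewrite p1 in p_pr.
pose SL j := (mesym 5 L j).@[fun i => trace_pow r.-1 (w ^+ (2 * i + 1))].
have SE j : S_ z bar sigma r.-1 j = SL j.
  exact: (S_traceE iota_z barE sigmaE).
have SL_rat j : (0 < j < 6)%N -> exists a : rat, SL j = ratr a.
  exact: (mesym_trace_rational iota_z).
(* The bridge used in both directions: the rational number [SL j] reduces to the symmetric function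
   computed in [K]. *)
have SL_num (K : fieldType) (u : K) j a : expsum u (seq.iota 0 11) = 0 ->
    23 != 0 :> K -> SL j = ratr a -> (numq a)%:~R = (denq a)%:~R *
    (mesym 5 K j).@[fun i => trace_pow r.-1 (u ^+ (2 * i + 1))].
  move=> Phi11_u nz23 SLa; apply: (specializes_rat Phi11_w Phi11_u nz23 iota).
  by rewrite -SLa; apply: specializes_mesym5.
rewrite !SE; split=> [M_pr | eqs].
  have [K [u [zeta23 [pcharM Phi11_u Phi23]]]] := exists_roots_pchar M_pr.
  have nz23 : 23 != 0 :> K by apply: (nz_pchar K M 23%N).
  have k_gt0 : (0 < r.-1)%N by rewrite -subn1 subn_gt0.
  have := traces_elementary_prime Phi11_u Phi23 pcharM M253 k_gt0 MEr.
  case=> S1 S2 S3 S4 S5.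
  have eqS j (c : int) : (0 < j < 6)%N ->
      (mesym 5 K j).@[fun i => trace_pow r.-1 (u ^+ (2 * i + 1))] = c%:~R ->
      eqmodQ M (SL j) c%:~R.
    move=> j_bnd Sc; have [a SLa] := SL_rat j j_bnd.
    apply: (residue_eqmodQ pcharM SLa); rewrite -Sc.
    exact: SL_num.
  have [K1 K4 K3] := lit K.
  by rewrite L1 L4 L3; split; apply: eqS => //;
    rewrite ?S1 ?S2 ?S3 ?S4 ?S5 ?K1 ?K4 ?K3.
have M_gt1 : (1 < M)%N by rewrite MEr ltnS expn_gt0.
apply/negPn/negP => M_npr; pose q := pdiv M.
have q_pr : prime q := pdiv_prime M_gt1.
have q_M : (q %| M)%N := pdiv_dvd M.
have [K [u [_ [pcharq Phi11_u _]]]] := exists_roots_pchar q_pr.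
have nz23 : 23 != 0 :> K by apply: (nz_pchar K q 23%N).
have nz11 : 11 != 0 :> K by apply: (nz_pchar K q 11%N).
have S_K j (c : int) : eqmodQ M (SL j) c%:~R ->
    (mesym 5 K j).@[fun i => trace_pow r.-1 (u ^+ (2 * i + 1))] = c%:~R.
  by apply: (eqmodQ_residue pcharq q_M) => a; apply: SL_num.
have traces : traces_elementary r.-1 u.
  have [K1 K4 K3] := lit K; move: eqs; rewrite L1 L4 L3.
  case=> /S_K S1 /S_K S2 /S_K S3 /S_K S4 /S_K S5.
  by rewrite /traces_elementary S1 S2 S3 S4 S5 K1 K4 K3.
have := traces_elementary_order Phi11_u pcharq nz11 nz23 traces.
rewrite prednK ?(ltnW r_gt1) // => q10.
have q2 : (q ^ 2 <= M)%N.
  by rewrite leqNgt; apply: contra M_npr; apply: ltn_pdiv2_prime; apply: ltnW.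
have q_lt : (q < 11 ^ r)%N.
  rewrite -(ltn_exp2r _ _ (isT : 0 < 2)%N); apply: leq_ltn_trans q2 _.
  rewrite MEr prednK ?(ltnW r_gt1) // -expnM mulnC expnM.
  (* 44^r is at most 121^r, and 2^r >= 4 absorbs the 1 in M = 22^r + 1, so that q^2 < 11^(2r). *)
  have le44 : (22 ^ r * 2 ^ r <= (11 ^ 2) ^ r)%N.
    by rewrite -expnMn leq_exp2r // ltnW.
  apply: leq_trans le44; have : (2 ^ 2 <= 2 ^ r)%N by rewrite leq_exp2l.
  have : (0 < 22 ^ r)%N by rewrite expn_gt0.
  by move: (22 ^ r)%N (2 ^ r)%N => a b; nia.
have : ~~ (q %| M)%N.
  apply: no_divisor; first by rewrite prime_gt1.
  by apply/eqP; rewrite eqn_mod_dvd // expn_gt0 prime_gt0.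
by rewrite q_M.
Qed.
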